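(* Let $\alpha>0$, $\beta>0$ and let $n\ge 0$ be an integer. For $t>0$ let $D_n(t)=\det\left(\int_0^1 x^{i+j}e^{-t/x}x^{\alpha}(1-x)^{\beta}\,dx\right)_{i,j=0}^{n-1}$ and $H_n(t):=t\frac{d}{dt}\ln D_n(t)$. Then $H_n$ satisfies, for all $t>0$, the non-linear second order ordinary differential equation $$(tH_n'')^2=\left[n(n+\alpha+\beta)-H_n+(\alpha+t)H_n'\right]^2+4H_n'\,(tH_n'-H_n)\,(\beta-H_n'),$$ where $'$ denotes $d/dt$.
   Context: Convention: $D_0:=1$, so $H_0=0$. *)

(* Defs.v *)
From HB Require Import structures.
From mathcomp Require Import all_boot all_order all_algebra.
From mathcomp Require Import all_classical all_reals all_analysis.

Set Implicit Arguments.
Unset Strict Implicit.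
Unset Printing Implicit Defensive.

Import Order.TTheory GRing.Theory Num.Theory.
Import numFieldNormedType.Exports.

Local Open Scope classical_set_scope.
Local Open Scope ring_scope.

(* At x = 0, where t / x evaluates to 0, the factor [x `^ alpha] makes this
   vanish for alpha != 0. *)
Definition pj_weight (R : realType) (alpha beta t x : R) : R :=
  expR (- (t / x)) * x `^ alpha * (1 - x) `^ beta.

Definition pj_moment (R : realType) (alpha beta t : R) (k : nat) : R :=
  \int[lebesgue_measure]_(x in `[0, 1]) (x ^+ k * pj_weight alpha beta t x).

(* For n = 0 this is the determinant of the empty matrix, i.e. 1. *)
Definition hankel_det (R : realType) (alpha beta : R) (n : nat) (t : R) : R :=
  \det (\matrix_(i < n, j < n) pj_moment alpha beta t (i + j)%N).

Definition H_fun (R : realType) (alpha beta : R) (n : nat) (t : R) : R :=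
  t * (fun s => ln (hankel_det alpha beta n s))^`()%classic t.

(* Main.v *)
Require Import Defs.
From HB Require Import structures.
From mathcomp Require Import all_boot all_order all_algebra.
From mathcomp Require Import all_classical all_reals all_analysis.
From mathcomp Require Import perm ring lra.
From mathcomp Require polyrcf.

(* Write M(s, t) for the integral of x^s (1 - x)^beta e^(-t/x) over [0, 1], for
   any real s. Since dM(s)/dt = - M(s - 1), with a = alpha + 2n - 2 the
   determinant D_n is the Wronskian-Hankel determinant tau_n of M(a), so that for
   fixed a the tau_k satisfy the Toda equation
   (ln tau_k)'' = tau_{k+1} tau_{k-1} / tau_k^2 (Desnanot-Jacobi identity), where
   tau_k > 0 since it is a Gram determinant. Put H_k = t (ln tau_k)' and
   y_k = t H_k' - H_k. The parameter alpha_k = a - 2k + 2 of tau_k varies with k,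
   and the differential equation is propagated in k as a Backlund transformation:
   with p_k = H_{k+1} - H_k + 1 - alpha_k, v_k = t H_k', c_k = k(k + alpha_k + beta)
   and B_k = t y_k + alpha_k v_k + c_k t, one proves by induction
     p (y p + B) = v (beta t - v),
     t p' = p (1 - t - alpha_k - p) + beta t - 2 v,
     t y' = 2 y p + B,
   the case k = 0 being the Riccati equation satisfied by H_1, i.e. the three-term
   recurrence of M. Then (t y')^2 - B^2 = 4 y p (y p + B) = 4 y v (beta t - v),
   which is the claim. *)

Set Implicit Arguments.
Unset Strict Implicit.
Unset Printing Implicit Defensive.

Import Order.TTheory GRing.Theory Num.Theory.
Import numFieldNormedType.Exports.

Local Open Scope classical_set_scope.
Local Open Scope ring_scope.

(** * Moments *)

Section Moments.
Variables (R : realType) (beta : R).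
Hypothesis hbeta : 0 < beta.

Local Notation mu := (@lebesgue_measure R).

(* Extending by 0 for [x <= 0] makes this continuous on [0, 1] for every
   real exponent [s]. *)
Definition kern (s t x : R) : R :=
  if 0 < x then expR (- (t / x)) * x `^ s * (1 - x) `^ beta else 0.

Lemma kern_ge0 (s t x : R) : 0 <= kern s t x.
Proof.
by rewrite /kern; case: ifP => // _; rewrite !mulr_ge0 ?expR_ge0 ?powR_ge0.
Qed.

Lemma kern_shift (s t x k : R) : 0 < x -> kern (s + k) t x = x `^ k * kern s t x.
Proof.
by move=> x0; rewrite /kern x0 /= powRD ?(gt_eqF x0) ?implybT//; ring.
Qed.

(** The Taylor term of order N of exp gives e^(-t/x) <= N! x^N / t^N, and N >= 1 - s absorbs x^s
    whatever the sign of s. The spare factor x forces the limit 0 at the left endpoint. *)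
Lemma kern_bound (s t : R) : 0 < t ->
  exists C, forall x, 0 < x <= 1 -> kern s t x <= C * x * (1 - x) `^ beta.
Proof.
move=> t0.
pose N := (Num.trunc `|1 - s|).+1.
have hN : 1 - s <= N%:R.
  by apply: le_trans (ler_norm _) _; apply: ltW; exact: truncnS_gt.
exists (N`!%:R / t ^+ N) => x /andP[x0 x1].
rewrite /kern x0 /= ler_wpM2r ?powR_ge0//.
have h2 : expR (- (t / x)) <= N`!%:R * x ^+ N / t ^+ N.
  have q0 : 0 < N`!%:R * x ^+ N / t ^+ N.
    by rewrite divr_gt0 ?mulr_gt0 ?exprn_gt0// ltr0n fact_gt0.
  rewrite expRN -[leRHS]invrK lef_pV2 ?posrE ?expR_gt0 ?invr_gt0//.
  have tx0 : 0 <= t / x by rewrite divr_ge0// ltW.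
  apply: le_trans (expR_ge1Dxn (Num.trunc `|1 - s|) tx0).
  have -> : (N`!%:R * x ^+ N / t ^+ N)^-1 = (t / x) ^+ N / N`!%:R.
    by rewrite expr_div_n; field; rewrite !gt_eqF ?exprn_gt0// ltr0n fact_gt0.
  by rewrite lerDr.
have h3 : x ^+ N * x `^ s <= x.
  have -> : x ^+ N * x `^ s = x `^ (N%:R + s).
    by rewrite powRD ?(gt_eqF x0) ?implybT// powR_mulrn// ltW.
  apply: (ge1r_powR _ _); [by rewrite x0|lra].
apply: le_trans (_ : N`!%:R * x ^+ N / t ^+ N * x `^ s <= _).
  by rewrite ler_wpM2r ?powR_ge0.
have -> : N`!%:R * x ^+ N / t ^+ N * x `^ s =
    N`!%:R / t ^+ N * (x ^+ N * x `^ s) by ring.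
by rewrite ler_wpM2l// divr_ge0// exprn_ge0// ltW.
Qed.

(** The extra factor 1 - z keeps (1 - x)^(beta - 1) out of the derivative, which is thus a
    combination of kernels with the same [beta]. *)
Lemma kern_is_derive_x (s t x : R) : 0 < x < 1 ->
  is_derive x 1 (fun z => (1 - z) * kern (s + 2) t z)
    (t * kern s t x + (s + 2 - t) * kern (s + 1) t x
     - (s + 3 + beta) * kern (s + 2) t x).
Proof.
move=> /andP[x0 x1].
apply: (@near_eq_is_derive R R^o R^o
  (fun z => expR (- (t / z)) * z `^ (s + 2) * ((1 - z) * (1 - z) `^ beta))).
  near=> z; rewrite /kern ifT; first by ring.
  by near: z; exact: lt_nbhsr.
have dx1 := is_derive1_powR (s + 2) x0.
have y0 : 0 < 1 - x by rewrite subr_gt0.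
have dx2 : is_derive x 1 (fun z => (1 - z) `^ beta)
   (- (beta * (1 - x) `^ (beta - 1))).
  have d1 : is_derive x 1 (fun z : R => 1 - z) (-1).
    apply: is_derive_eq; ring.
  have d2 := @is_derive1_powR _ beta _ y0.
  have := @is_derive1_comp _ _ (fun z : R => 1 - z) _ _ _ d2 d1.
  by rewrite mulrN1.
have dx3 : is_derive x 1 (fun z => expR (- (t / z))) (t / x ^+ 2 * expR (- (t / x))).
  have d1 : is_derive x 1 (fun z : R => - (t / z)) (t / x ^+ 2).
    have d1' : is_derive x 1 (fun z : R => z^-1) (- x ^- 2).
      have x_neq0 : x != 0 by rewrite gt_eqF.
      have := @is_deriveV _ id x 1 1 x_neq0 (is_derive_id _ _).
      by rewrite /GRing.scale/= mulr1.
    by apply: is_derive_eq; rewrite /GRing.scale/=; ring.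
  have := @is_derive1_comp _ _ (fun z : R => - (t / z)) _ _ _ (is_derive_expR _) d1.
  by rewrite mulrC.
apply: is_derive_eq; rewrite /GRing.scale/= /kern x0 /=.
have e1 : x `^ (s + 2 - 1) = x * x `^ s.
  have -> : s + 2 - 1 = 1 + s by ring.
  by rewrite powRD ?(gt_eqF x0) ?implybT// powRr1 ?ltW.
have e2 : x `^ (s + 2) = x ^+ 2 * x `^ s.
  by rewrite addrC powRD ?(gt_eqF x0) ?implybT// powR_mulrn ?ltW.
have e3 : x `^ (s + 1) = x * x `^ s.
  by rewrite addrC powRD ?(gt_eqF x0) ?implybT// powRr1 ?ltW.
have e4 : (1 - x) `^ beta = (1 - x) * (1 - x) `^ (beta - 1).
  by rewrite mulr_powRB1// ltW.
rewrite e1 e2 e3 e4.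
by field; rewrite gt_eqF.
Unshelve. all: by end_near. Qed.

Lemma kern_continuous s t : 0 < t -> {within `[0, 1], continuous (kern s t)}.
Proof.
move=> t0.
have [C hC] := kern_bound s t0.
have k01 : kern s t x @[x --> (0 : R)^'+] --> 0.
  apply: (@squeeze_cvgr _ _ _ _ (cst 0) (fun x => C * x * (1 - x) `^ beta)).
  + near=> x; rewrite kern_ge0/= hC//.
    by apply/andP; split; near: x; [exact: nbhs_right_gt|exact: nbhs_right_le].
  + exact: cvg_cst.
  + have e0 : C * 0 * (1 - 0) `^ beta = 0 by ring.
    rewrite -[X in _ --> X]e0.
    apply: cvg_at_right_filter; apply: cvgM.
      by apply: cvgM; [exact: cvg_cst|exact: cvg_id].
    apply: (@cvg_comp _ _ _ (fun x => 1 - x) (fun x => x `^ beta) _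
      (nbhs (1 - 0 : R))).
      by apply: cvgB; [exact: cvg_cst|exact: cvg_id].
    have s0 : 0 < 1 - 0 :> R by lra.
    have [/derivable1_diffP/differentiable_continuous + _] :=
      is_derive1_powR beta s0.
    exact.
have k11 : kern s t x @[x --> (1 : R)^'-] --> 0.
  apply: (@squeeze_cvgr _ _ _ _ (cst 0) (fun x => C * x * (1 - x) `^ beta)).
  + near=> x; rewrite kern_ge0/= hC//.
    by apply/andP; split; near: x; [exact: nbhs_left_gt|exact: nbhs_left_le].
  + exact: cvg_cst.
  + rewrite -[X in _ --> X](mulr0 (C * 1)); apply: cvgM.
      by apply: cvg_at_left_filter; apply: cvgM; [exact: cvg_cst|exact: cvg_id].
    have h : 1 - x @[x --> (1 : R)^'-] --> (0 : R)^'+.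
      move=> P [e /= e0 He]; exists e => //= y ye y1.
      by apply: He; rewrite /= ?subr_gt0// sub0r opprB distrC.
    exact: (cvg_comp _ _ h (powR_cvg0 hbeta)).
apply/continuous_within_itvP => //; split.
(* In the interior, continuity is read off from the differentiability of (1 - z) [kern], taken at
   exponent s - 2, after division by 1 - z. *)
- move=> x; rewrite in_itv/= => x01.
  have /andP[x0 x1] := x01.
  have [/derivable1_diffP/differentiable_continuous hc _] :=
    kern_is_derive_x (s - 2) t x01.
  have h : (1 - z)^-1 * ((1 - z) * kern (s - 2 + 2) t z) @[z --> x] -->
      (1 - x)^-1 * ((1 - x) * kern (s - 2 + 2) t x).
    apply: cvgM => //; apply: cvgV; first by rewrite subr_eq0 gt_eqF.
    by apply: cvgB; [exact: cvg_cst|exact: cvg_id].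
  rewrite subrK mulKf ?subr_eq0 ?gt_eqF// in h.
  apply: cvg_trans h; apply: near_eq_cvg.
  near=> z; rewrite mulKf// subr_eq0 gt_eqF//.
  by near: z; exact: lt_nbhsl.
- by rewrite [X in _ --> X]/kern ltxx.
- by rewrite [X in _ --> X]/kern ltr01 subrr powR0 ?gt_eqF// mulr0.
Unshelve. all: by end_near. Qed.

Definition mom (s t : R) : R := \int[mu]_(x in `[0, 1]) kern s t x.

Lemma kern_integrable s t : 0 < t -> mu.-integrable `[0, 1] (EFin \o kern s t).
Proof.
move=> t0; apply: continuous_compact_integrable; first exact: segment_compact.
exact: kern_continuous.
Qed.

(** Integration of [kern_is_derive_x] over [0, 1]. The boundary terms vanish: at 0 by the convention
    in [kern], at 1 by the factor 1 - x. *)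
Lemma mom_recurrence s t : 0 < t ->
  t * mom s t + (s + 2 - t) * mom (s + 1) t = (s + 3 + beta) * mom (s + 2) t.
Proof.
move=> t0.
pose F x := (1 - x) * kern (s + 2) t x.
pose f x := t * kern s t x + (s + 2 - t) * kern (s + 1) t x
            - (s + 3 + beta) * kern (s + 2) t x.
have ck := fun s' => @kern_continuous s' t t0.
have ik := fun s' => @kern_integrable s' t t0.
have iZ c s' : mu.-integrable `[0, 1] (EFin \o (fun x => c * kern s' t x)).
  rewrite (_ : _ \o _ = (fun x => (c%:E * (kern s' t x)%:E)%E)); last first.
    by apply/funext => x /=; rewrite EFinM.
  by apply: integrableZl => //; exact: ik.
have iD c d s1 s2 : mu.-integrable `[0, 1]
    (EFin \o (fun x => c * kern s1 t x + d * kern s2 t x)).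
  rewrite (_ : _ \o _ =
    (fun x => ((c * kern s1 t x)%:E + (d * kern s2 t x)%:E)%E)); last first.
    by apply/funext => x /=; rewrite EFinD.
  by apply: integrableD => //; exact: iZ.
have cf : {within `[0, 1], continuous f}.
  by move=> x; apply: cvgB; [apply: cvgD|]; apply: cvgM;
     first [exact: cvg_cst|exact: ck].
have cF : {within `[0, 1], continuous F}.
  move=> x; apply: cvgM; last exact: ck.
  apply: cvgB; first exact: cvg_cst.
  by apply: continuous_subspaceT => y; exact: cvg_id.
have FLR : derivable_oo_LRcontinuous F 0 1.
  have /(continuous_within_itvP _ ltr01)[_ ? ?] := cF.
  split => // x; rewrite in_itv/= => x01.
  by have [] := kern_is_derive_x s t x01.
have F'f : {in `]0, 1[, F^`()%classic =1 f}.
  move=> x; rewrite in_itv/= => x01; rewrite derive1E.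
  by have [_] := kern_is_derive_x s t x01.
have := continuous_FTC2 ltr01 cf FLR F'f.
rewrite /F /kern ltxx subrr mulr0 mul0r subee//.
move=> /(congr1 fine); rewrite -/(Rintegral mu _ f) /f.
rewrite RintegralB//= ?RintegralD//=.
by rewrite !RintegralZl//= => /eqP; rewrite subr_eq0 => /eqP.
Qed.

Lemma kern_is_derive_t (s t x : R) :
  is_derive t 1 (fun u => kern s u x) (- kern (s - 1) t x).
Proof.
rewrite /kern; case: ifPn => [x0|_]; last by rewrite oppr0; exact: is_derive_cst.
have d1 : is_derive t 1 (fun u : R => - (u / x)) (- x^-1).
  by apply: is_derive_eq; rewrite /GRing.scale/=; ring.
have d2 := @is_derive1_comp _ _ (fun u : R => - (u / x)) _ _ _ (is_derive_expR _) d1.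
apply: is_derive_eq; rewrite /GRing.scale/= powRD ?(gt_eqF x0) ?implybT//.
by rewrite powR_inv1 ?ltW//; ring.
Qed.

Lemma kern_le_t (s t u x : R) : u <= t -> kern s t x <= kern s u x.
Proof.
move=> ut; rewrite /kern; case: ifPn => // x0.
rewrite ler_wpM2r ?powR_ge0// ler_wpM2r ?powR_ge0// ler_expR lerN2.
by rewrite ler_wpM2r// invr_ge0 ltW.
Qed.

(** Differentiation under the integral on ]t/2, 2t[: the kernel decreases in t, so its value at t/2
    is an integrable dominating function. *)
Lemma mom_is_derive (s t : R) : 0 < t ->
  is_derive t 1 (mom s) (- mom (s - 1) t).
Proof.
move=> t0.
have It : `](t / 2), (t * 2)[%classic t by rewrite /= in_itv/=; lra.
have intf u : `](t / 2), (t * 2)[%classic u ->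
    mu.-integrable `[0, 1] (EFin \o kern s u).
  by rewrite /= in_itv/= => /andP[? _]; apply: kern_integrable; lra.
have derf u x : `](t / 2), (t * 2)[%classic u -> `[0, 1]%classic x ->
    derivable (fun v => kern s v x) u 1.
  by move=> _ _; have [] := kern_is_derive_t s u x.
have d1E u x : partial1of2 (kern s) u x = - kern (s - 1) u x.
  by rewrite partial1of2E; have [_] := kern_is_derive_t s u x.
have t20 : 0 < t / 2 by lra.
have hb u x : `](t / 2), (t * 2)[%classic u -> `[0, 1]%classic x ->
    `|partial1of2 (kern s) u x| <= kern (s - 1) (t / 2) x.
  rewrite /= in_itv/= => /andP[tu _] _.
  by rewrite d1E normrN ger0_norm ?kern_ge0//; apply: kern_le_t; exact: ltW.
have m01 : measurable (`[0, 1]%classic : set R) by [].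
have ik := @kern_integrable (s - 1) (t / 2) t20.
have k0 := fun x => kern_ge0 (s - 1) (t / 2) x.
have dd := @derivable_under_integral R _ _ mu (kern s) _ m01 _ _ _
  It intf derf _ k0 ik hb.
have dv := @differentiation_under_integral R _ _ mu (kern s) _ m01 _ _ _
  It intf derf _ k0 ik hb.
apply: DeriveDef => //.
rewrite -derive1E dv.
transitivity (\int[mu]_(x in `[0, 1]) (-1 * kern (s - 1) t x)).
  by apply: eq_Rintegral => x _; rewrite d1E mulN1r.
by rewrite RintegralZl ?mulN1r//; exact: kern_integrable.
Qed.

End Moments.

(** * Determinants *)

(** Along the segment (1 - s) I + s A from the identity to [A] the quadratic form stays positive, so
    the determinant, a polynomial in s equal to 1 at s = 0, has no root in [0, 1]; the intermediate
    value theorem for polynomials then fixes its sign at s = 1. *)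
Lemma posdef_det_gt0 (R : rcfType) n (A : 'M[R]_n) :
  (forall u : 'rV_n, u != 0 -> 0 < (u *m A *m u^T) 0 0) -> 0 < \det A.
Proof.
move=> Apos.
pose M (s : R) : 'M[R]_n := (1 - s)%:M + s *: A.
pose P : 'M[{poly R}]_n := (1 - 'X)%:M + 'X *: map_mx polyC A.
have PE s : (\det P).[s] = \det (M s).
  rewrite -[LHS]/(horner_eval s (\det P)) -det_map_mx; congr (\det _).
  apply/matrixP => i j; rewrite !mxE /= /horner_eval.
  by case: (i == j); rewrite ?mulr1n ?mulr0n !hornerE; ring.
have Mneq0 s : 0 <= s <= 1 -> \det (M s) != 0.
  move=> /andP[s0 s1]; apply/negP => /eqP/eqP/det0P[u u0 uM].
  have uu : 0 < (u *m u^T) 0 0.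
    rewrite mxE; under eq_bigr do rewrite mxE -expr2.
    rewrite lt0r sumr_ge0 ?andbT; last by move=> i _; exact: sqr_ge0.
    apply: contra u0 => /eqP/psumr_eq0P h; apply/eqP/rowP => i.
    apply/eqP; rewrite mxE -sqrf_eq0; apply/eqP/h => // j _; exact: sqr_ge0.
  have := congr1 (fun w : 'rV_n => (w *m u^T) 0 0) uM.
  rewrite /M mulmxDr mulmxDl mul_mx_scalar -scalemxAr -!scalemxAl mul0mx.
  rewrite !mxE => /eqP; apply/negP.
  move: (Apos u u0) uu; rewrite !mxE => q1 q2.
  rewrite gt_eqF//.
  have [->|s_neq1] := eqVneq s 1; first by rewrite subrr mul0r add0r mul1r.
  have s_lt1 : s < 1 by rewrite lt_neqAle s_neq1.
  by apply: ltr_wpDr; [rewrite mulr_ge0// ltW|rewrite mulr_gt0// subr_gt0].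
have d0 : 0 < (\det P).[0] by rewrite PE /M subr0 scale0r addr0 det1 ltr01.
have d1 : (\det P).[1] = \det A by rewrite PE /M subrr scale1r raddf0 add0r.
rewrite ltNge; apply/negP => A0.
have [|s s01] := @poly_ivt R (- \det P) 0 1 ler01.
  by rewrite !hornerN oppr_le0 oppr_ge0 (ltW d0) d1.
by rewrite rootE hornerN oppr_eq0 PE; apply/negP/Mneq0.
Qed.

Lemma is_derive_sum_seq (R : realType) (I : Type) (r : seq I) (f : I -> R -> R)
    (df : I -> R) (t : R) :
  (forall i, is_derive t 1 (f i) (df i)) ->
  is_derive t 1 (fun s => \sum_(i <- r) f i s) (\sum_(i <- r) df i).
Proof.
move=> fE; elim: r => [|i r IH].
  rewrite big_nil; under eq_fun do rewrite big_nil; exact: is_derive_cst.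
rewrite big_cons; under eq_fun do rewrite big_cons; exact: is_deriveD.
Qed.

Lemma is_derive_prod (R : realType) n (f : 'I_n -> R -> R) (df : 'I_n -> R) (t : R) :
  (forall i, is_derive t 1 (f i) (df i)) ->
  is_derive t 1 (fun s => \prod_(i < n) f i s)
    (\sum_(i < n) \prod_(k < n) (if k == i then df k else f k t)).
Proof.
elim: n f df => [|n IH] f df fE.
  rewrite big_ord0; under eq_fun do rewrite big_ord0; exact: is_derive_cst.
under eq_fun do rewrite big_ord_recl.
have d1 := IH (fun i => f (lift ord0 i)) (fun i => df (lift ord0 i)) (fun i => fE _).
have d0 := fE ord0.
apply: is_derive_eq; rewrite /GRing.scale/= big_ord_recl big_ord_recl eqxx.
rewrite addrC; congr (_ + _).
  by rewrite mulrC; congr (_ * _); apply: eq_bigr => k _.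
rewrite mulr_sumr; apply: eq_bigr => i _; by rewrite big_ord_recl /=; congr (_ * _).
Qed.

Lemma is_derive_det (R : realType) n (A : R -> 'M[R]_n) (dA : 'M[R]_n) (t : R) :
  (forall i j, is_derive t 1 (fun s => A s i j) (dA i j)) ->
  is_derive t 1 (fun s => \det (A s))
    (\sum_i \det (\matrix_(k, j) (if k == i then dA k j else A t k j))).
Proof.
move=> AE.
have -> : \sum_i \det (\matrix_(k, j) (if k == i then dA k j else A t k j)) =
    \sum_(s : 'S_n) (-1) ^+ s *
      \sum_i \prod_k (if k == i then dA k (s k) else A t k (s k)).
  under [RHS]eq_bigr do rewrite mulr_sumr.
  rewrite [RHS]exchange_big /=; apply: eq_bigr => i _.
  by apply: eq_bigr => s _; congr (_ * _); apply: eq_bigr => k _; rewrite mxE.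
apply: is_derive_sum_seq => s.
exact: is_deriveZ (is_derive_prod (fun k => AE k (s k))).
Qed.

Lemma det_schur (R : fieldType) m n (P : 'M[R]_m) (Q : 'M[R]_(m, n))
    (S : 'M[R]_(n, m)) (T : 'M[R]_n) : P \in unitmx ->
  \det (block_mx P Q S T) = \det P * \det (T - S *m invmx P *m Q).
Proof.
move=> Pu.
have -> : block_mx P Q S T =
  block_mx P 0 S 1%:M *m block_mx 1%:M (invmx P *m Q) 0 (T - S *m invmx P *m Q).
  rewrite mulmx_block !mulmx1 !mul1mx !mulmx0 !mul0mx !addr0 mulKVmx//.
  by rewrite mulmxA addrC subrK.
by rewrite det_mulmx det_lblock det_ublock !det1 mulr1 mul1r.
Qed.

Lemma det_mx22 (R : comNzRingType) (A : 'M[R]_2) :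
  \det A = A 0 0 * A 1 1 - A 0 1 * A 1 0.
Proof.
rewrite (expand_det_row _ 0) !big_ord_recl big_ord0 /cofactor !det_mx11 !mxE /=.
rewrite addr0 expr0 expr1 mul1r mulN1r mulrN.
by congr (A _ _ * A _ _ - A _ _ * A _ _); apply: val_inj.
Qed.

(** * The Desnanot-Jacobi identity *)

Section Jacobi.
Variables (R : fieldType) (F : nat -> nat -> R).

Definition minor n (r c : nat -> nat) : R :=
  \det (\matrix_(i < n, j < n) F (r i) (c j)).

(** On the first m + 1 indices this selects 0, ..., m - 1, m + 1: the last row or column is replaced
    by the next one. *)
Definition skip m i := if (i < m)%N then i else i.+1.

Variable m : nat.
Let P : 'M[R]_m := \matrix_(i, j) F i j.
(** Entries of the Schur complement of the leading block [P], for arbitrary row and column indices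
    of [F]. *)
Let g i j := F i j - \sum_(k < m) (\sum_(l < m) F i l * invmx P l k) * F k j.

Let minor_schur n r c : P \in unitmx ->
    (forall i, (i < m)%N -> r i = i) -> (forall i, (i < m)%N -> c i = i) ->
  minor (m + n) r c =
  \det P * \det (\matrix_(i < n, j < n) g (r (m + i)%N) (c (m + j)%N)).
Proof.
move=> Pu rE cE.
rewrite /minor -(submxK (\matrix_(i, j) _)).
have -> : ulsubmx (\matrix_(i < m + n, j < m + n) F (r i) (c j)) = P.
  by apply/matrixP => i j; rewrite !mxE /= rE// cE.
rewrite det_schur//; congr (_ * \det _); apply/matrixP => i j.
rewrite !mxE /g; congr (_ - _); apply: eq_bigr => k _; rewrite !mxE /= [r k]rE//.
by congr (_ * _); apply: eq_bigr => l _; rewrite !mxE /= [c l]cE.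
Qed.

(** Once det [P] is factored out of every minor, what remains is the formula for the 2 x 2
    determinant of [g] on the indices m and m + 1. *)
Lemma minor_jacobi : minor m id id != 0 ->
  minor m.+1 (skip m) (skip m) * minor m.+1 id id
  - minor m.+1 id (skip m) * minor m.+1 (skip m) id =
  minor m.+2 id id * minor m id id.
Proof.
move=> P0; have Pu : P \in unitmx by rewrite unitmxE unitfE.
have skipE i : (i < m)%N -> skip m i = i by rewrite /skip => ->.
rewrite -[m.+2]addn2 -[m.+1]addn1 !minor_schur// -[minor m id id]/(\det P).
rewrite det_mx22 !det_mx11 !mxE /= !addn0 addn1 /skip ltnn; ring.
Qed.

End Jacobi.

(** * Positivity of the Gram determinants *)

Lemma Rintegral_sum d (T : measurableType d) (R : realType)
    (mu : {measure set T -> \bar R}) (D : set T)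
    (I : Type) (r : seq I) (f : I -> T -> R) :
  measurable D -> (forall i, mu.-integrable D (EFin \o f i)) ->
  mu.-integrable D (EFin \o (fun x => \sum_(i <- r) f i x)) /\
  \int[mu]_(x in D) (\sum_(i <- r) f i x) = \sum_(i <- r) \int[mu]_(x in D) f i x.
Proof.
move=> mD fi; elim: r => [|i r [IH1 IH2]].
  have -> : (fun x => \sum_(i <- [::]) f i x) = cst 0.
    by apply/funext => x; rewrite big_nil.
  rewrite big_nil; split; first exact: integrable0.
  by rewrite Rintegral_cst ?mul0r.
have -> : (fun x => \sum_(j <- i :: r) f j x) =
    (fun x => f i x + \sum_(j <- r) f j x).
  by apply/funext => x; rewrite big_cons.
rewrite big_cons -IH2 RintegralD//; split => //.
have -> : EFin \o (fun x => f i x + \sum_(j <- r) f j x) =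
    (fun x => (f i x)%:E + (\sum_(j <- r) f j x)%:E)%E.
  by apply/funext => x /=; rewrite EFinD.
by apply: integrableD => //; exact: fi.
Qed.

(** A zero integral would make f vanish almost everywhere, so that [0, 1] would be covered by a null
    set and a finite set, against its measure 1. *)
Lemma integral_gt0_cofinite (R : realType) (f : R -> R) (s : seq R) :
  (forall x, 0 <= f x) -> lebesgue_measure.-integrable `[0, 1] (EFin \o f) ->
  (forall x, 0 <= x <= 1 -> f x = 0 -> x \in s) ->
  0 < \int[lebesgue_measure]_(x in `[0, 1]) f x.
Proof.
move=> f0 intf fs; rewrite lt0r Rintegral_ge0 ?andbT//.
apply/eqP => I0.
have m01 : measurable (`[0, 1]%classic : set R) by [].
have If : (\int[lebesgue_measure]_(x in `[0%R, 1%R]) (f x)%:E = 0)%E.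
  rewrite -[LHS]fineK; last exact: integrable_fin_num.
  by rewrite -/(Rintegral lebesgue_measure _ f) I0.
have /integrableP[mf _] := intf.
have : ae_eq lebesgue_measure (`[0, 1]%classic : set R) (EFin \o f) (cst 0%E).
  apply/ae_eq_integral_abs => //; rewrite -[RHS]If.
  by apply: eq_integral => x _ /=; rewrite ger0_norm.
move=> hN.
have hS : lebesgue_measure.-negligible [set` s].
  apply/negligibleP.
    exact/countable_measurable/finite_set_countable/finite_seq.
  exact/countable_lebesgue_measure0/finite_set_countable/finite_seq.
have : lebesgue_measure.-negligible (`[0, 1]%classic : set R).
  apply: negligibleS (negligibleU hN hS) => x /= x01.
  have [fx0|fx0] := eqVneq (f x) 0.
    by right; apply: fs => //; move: x01; rewrite in_itv.
  by left => /(_ x01) [] /eqP; rewrite (negbTE fx0).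
move=> /negligibleP => /(_ m01) mu0.
have := etrans (esym mu0) (@lebesgue_measure_itv R `[0, 1]).
rewrite /= lte_fin ltr01 oppr0 adde0 => /esym/eqP.
by rewrite onee_eq0.
Qed.

Section Gram.
Variables (R : realType) (beta : R).
Hypothesis hbeta : 0 < beta.
Local Notation mu := (@lebesgue_measure R).

Variable a : R.

(** The exponents decrease because each t-derivative lowers them by 1: the entry is (-d/dt)^(i+j)
    M(a). *)
Definition moment_entry t (i j : nat) : R := mom beta (a - i%:R - j%:R) t.

Lemma kern_poly t x n (u : 'rV[R]_n) :
  (rVpoly u).[x^-1] ^+ 2 * kern beta a t x =
  \sum_(ij : 'I_n * 'I_n)
    u 0 ij.1 * u 0 ij.2 * kern beta (a - ij.1%:R - ij.2%:R) t x.
Proof.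
have [x0|x0] := ltP 0 x; last first.
  have k0 s : kern beta s t x = 0 by rewrite /kern ltNge x0.
  by rewrite k0 mulr0 big1// => ij _; rewrite k0 mulr0.
rewrite horner_poly expr2 big_distrlr /= pair_bigA /= mulr_suml.
apply: eq_bigr => -[i j] _ /=; rewrite !valK.
have -> : a - i%:R - j%:R = a + - (i + j)%:R by rewrite natrD; ring.
rewrite kern_shift// powRN powR_mulrn ?ltW// exprD.
rewrite !exprVn invfM; ring.
Qed.

(** The quadratic form at u is the integral of the kernel times the square of a nonzero polynomial
    in 1/x with coefficients u. *)
Lemma moment_minor_gt0 n t : 0 < t -> 0 < minor (moment_entry t) n id id.
Proof.
move=> t0; apply: posdef_det_gt0 => u u0.
have m01 : measurable (`[0, 1]%classic : set R) by [].
have intk (ij : 'I_n * 'I_n) : mu.-integrable `[0, 1] (EFin \o (fun x =>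
    u 0 ij.1 * u 0 ij.2 * kern beta (a - ij.1%:R - ij.2%:R) t x)).
  rewrite (_ : _ \o _ = (fun x => ((u 0 ij.1 * u 0 ij.2)%:E *
      (kern beta (a - ij.1%:R - ij.2%:R) t x)%:E)%E)).
    by apply: integrableZl => //; exact: kern_integrable.
  by apply/funext => x /=; rewrite EFinM.
have [intS sE] := @Rintegral_sum _ _ R mu _ _ (index_enum _) _ m01 intk.
have kE : (fun x => (rVpoly u).[x^-1] ^+ 2 * kern beta a t x) =
    (fun x => \sum_(ij : 'I_n * 'I_n)
       u 0 ij.1 * u 0 ij.2 * kern beta (a - ij.1%:R - ij.2%:R) t x).
  by apply/funext => x; exact: kern_poly.
have {}sE : \int[mu]_(x in `[0, 1]) (\sum_(ij : 'I_n * 'I_n)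
       u 0 ij.1 * u 0 ij.2 * kern beta (a - ij.1%:R - ij.2%:R) t x) =
    \sum_(ij : 'I_n * 'I_n) u 0 ij.1 * u 0 ij.2 * moment_entry t ij.1 ij.2.
  rewrite sE; apply: eq_bigr => ij _; rewrite RintegralZl//.
  exact: kern_integrable.
have mE : (u *m (\matrix_(i < n, j < n) moment_entry t i j) *m u^T) 0 0 =
    \int[mu]_(x in `[0, 1]) ((rVpoly u).[x^-1] ^+ 2 * kern beta a t x).
  rewrite kE sE -(pair_bigA _ (fun i j => u 0 i * u 0 j * moment_entry t i j))/=.
  rewrite exchange_big mxE; apply: eq_bigr => j _; rewrite !mxE mulr_suml.
  by apply: eq_bigr => i _; rewrite !mxE; ring.
rewrite mE.
(* The integrand vanishes only where the kernel does, at 0 and 1, or where 1/x is a root of the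
   polynomial. *)
apply: (@integral_gt0_cofinite _ _
  [:: 0, 1 & [seq z^-1 | z <- polyrcf.rootsR (rVpoly u)]]).
- by move=> x; rewrite mulr_ge0 ?sqr_ge0 ?kern_ge0.
- by rewrite kE.
- move=> x x01 /eqP; rewrite !inE.
  have [//|x_neq0] := eqVneq x 0.
  have [//|x_neq1] := eqVneq x 1.
  have x0 : 0 < x by rewrite lt_neqAle eq_sym x_neq0; case/andP: x01.
  have x1 : 0 < 1 - x by rewrite subr_gt0 lt_neqAle x_neq1; case/andP: x01.
  rewrite mulf_eq0 expf_eq0/= => /orP[rx|]; last first.
    by rewrite /kern x0 gt_eqF// !mulr_gt0 ?expR_gt0 ?powR_gt0.
  rewrite -[x in x \in _]invrK map_f//.
  have p0 : rVpoly u != 0.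
    by apply: contra u0 => /eqP pu; rewrite -[u]rVpolyK pu raddf0.
  have /(_ x^-1) := polyrcf.roots_on_rootsR p0.
  by rewrite in_itv/= rootE rx => <-.
Qed.

End Gram.

(** * Propagation along the Toda chain *)

Lemma is_derive_unique (R : numFieldType) (V W : normedModType R)
    (f g : V -> W) (x u : V) (df dg : W) :
  {near x, f =1 g} -> is_derive x u f df -> is_derive x u g dg -> df = dg.
Proof. by move=> fg [_ <-] [_ <-]; exact: near_eq_derive. Qed.

Section TodaInduction.
Variables (R : realType) (a beta : R) (H y : nat -> R -> R).

Let al n : R := a - 2 * n%:R + 2.
Let c n : R := n%:R * (n%:R + al n + beta).
Let p n (t : R) : R := H n.+1 t - H n t + 1 - al n.
(** By [H_is_derive] this is t H_n'. *)
Let v n (t : R) : R := y n t + H n t.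
Let B n (t : R) : R := t * y n t + al n * v n t + c n * t.

Hypothesis H_is_derive : forall n (t : R), 0 < t ->
  is_derive t 1 (H n) ((y n t + H n t) / t).
Hypothesis y_neq0 : forall n (t : R), 0 < t -> y n.+1 t != 0.
Hypothesis y_is_derive : forall n (t : R), 0 < t ->
  is_derive t 1 (y n.+1) (y n.+1 t * (2 + H n.+2 t + H n t - 2 * H n.+1 t) / t).
Hypothesis H0 : forall t, 0 < t -> H 0 t = 0.
Hypothesis y0 : forall t, 0 < t -> y 0 t = 0.
Hypothesis riccati : forall t, 0 < t ->
  y 1 t = (a - t) * H 1 t + (a + 1 + beta) * t - H 1 t ^+ 2.

Let al_succ n : al n.+1 = al n - 2.
Proof. by rewrite /al -natr1; ring. Qed.

Let c_succ n : c n.+1 = c n + al n - 1 + beta.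
Proof. by rewrite /c al_succ /al -natr1; ring. Qed.

Let p_is_derive n (t : R) : 0 < t -> is_derive t 1 (p n) ((v n.+1 t - v n t) / t).
Proof.
move=> t0.
have d1 := H_is_derive n.+1 t0; have d2 := H_is_derive n t0.
by apply: is_derive_eq; rewrite /v; ring.
Qed.

(** Since t p_n' = v_{n+1} - v_n, the equation for t p_n' is stated in the second clause without a
    derivative. *)
Let toda_invariant n t :=
  [/\ p n t * (y n t * p n t + B n t) = v n t * (beta * t - v n t),
      v n.+1 t = p n t * (1 - t - al n - p n t) + beta * t - v n t &
      is_derive t 1 (y n) ((2 * y n t * p n t + B n t) / t)].

Let toda_invariant_base (t : R) : 0 < t -> toda_invariant 0 t.
Proof.
move=> t0; split.
- by rewrite /B /v /c y0 // H0 //; ring.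
- by rewrite /p /v /al riccati// H0// y0//; ring.
- apply: (@near_eq_is_derive R R^o R^o (cst 0)).
    by near=> z; rewrite y0//; near: z; exact: lt_nbhsr.
  apply: is_derive_eq; rewrite /B /v /c y0 // H0 //; ring.
Unshelve. all: by end_near. Qed.

(** Differentiate the second clause: the left side is computed by the Toda equation, the right side
    by the third clause, and the second clause itself removes v_{n+1}. *)
Let toda_link n : (forall t, 0 < t -> toda_invariant n t) ->
  forall t, 0 < t -> y n.+1 t * (p n.+1 t + p n t) = - B n.+1 t.
Proof.
move=> IH t t0; have [P1 P2 P3] := IH _ t0.
have dy := y_is_derive n t0; have dH := H_is_derive n.+1 t0.
have dH0 := H_is_derive n t0.
have dp := p_is_derive n t0.
have t_neq0 : t != 0 by rewrite gt_eqF.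
have L : is_derive t 1 (v n.+1) ((y n.+1 t * (p n.+1 t - p n t) + v n.+1 t) / t).
  by apply: is_derive_eq; rewrite /p /v al_succ; ring.
have Rh : is_derive t 1 (fun u => p n u * (1 - u - al n - p n u) + beta * u - v n u)
  ((v n.+1 t - v n t) / t * (1 - t - al n - p n t) - p n t
   - p n t * ((v n.+1 t - v n t) / t) + beta
   - ((2 * y n t * p n t + B n t) + v n t) / t).
  by apply: is_derive_eq; rewrite /GRing.scale/= /v; ring.
have E : {near t, v n.+1 =1
    (fun u => p n u * (1 - u - al n - p n u) + beta * u - v n u)}.
  near=> u; have [|_ -> _] := IH u; last by [].
  by near: u; exact: lt_nbhsr.
have := is_derive_unique E L Rh.
move/(congr1 (fun z => z * t)).
rewrite divfK//.
have -> : ((v n.+1 t - v n t) / t * (1 - t - al n - p n t) - p n t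
   - p n t * ((v n.+1 t - v n t) / t) + beta
   - ((2 * y n t * p n t + B n t) + v n t) / t) * t =
  (v n.+1 t - v n t) * (1 - t - al n - p n t) - p n t * t
   - p n t * (v n.+1 t - v n t) + beta * t
   - ((2 * y n t * p n t + B n t) + v n t) by field.
have eK : H n.+1 t = p n t + v n t - y n t - 1 + al n by rewrite /p /v; ring.
have eY : y n.+1 t = v n.+1 t - H n.+1 t by rewrite /v; ring.
move=> /eqP; rewrite -subr_eq0 => /eqP Q.
apply/eqP; rewrite -subr_eq0 -Q /B al_succ c_succ eY eK P2; apply/eqP; ring.
Unshelve. all: by end_near. Qed.

(** By [toda_link], p_n and p_{n+1} have sum -B_{n+1} / y_{n+1}, so y_{n+1} X^2 + B_{n+1} X takes
    the same value at both; this carries the first clause over. The second clause is the derivative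
    of the link relation divided by y_{n+1}, and the third is the Toda equation with p_n
    eliminated. *)
Let toda_invariant_step n : (forall t, 0 < t -> toda_invariant n t) ->
  forall t, 0 < t -> toda_invariant n.+1 t.
Proof.
move=> IH t t0; have [P1 P2 P3] := IH _ t0.
have link := toda_link IH.
have eK : H n.+1 t = p n t + v n t - y n t - 1 + al n by rewrite /p /v; ring.
have eY : y n.+1 t = v n.+1 t - H n.+1 t by rewrite /v; ring.
have eB : B n.+1 t = - (y n.+1 t * (p n.+1 t + p n t)) by rewrite (link t t0) opprK.
have dy := y_is_derive n t0.
have t_neq0 : t != 0 by rewrite gt_eqF.
split.
- (* eliminating [p n.+1] by the link relation, the claim is [P1] *)
  have -> : y n.+1 t * p n.+1 t + B n.+1 t =
    - (y n.+1 t * p n t) by rewrite eB; ring.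
  have -> : p n.+1 t * - (y n.+1 t * p n t) = p n t * (y n.+1 t * p n t + B n.+1 t).
    by rewrite eB; ring.
  move/eqP : P1; rewrite -subr_eq0 => /eqP Q.
  apply/eqP; rewrite -subr_eq0 -Q /B al_succ c_succ eY eK P2; apply/eqP; ring.
- have dH := H_is_derive n.+1 t0.
  have dp := p_is_derive n t0; have dp1 := p_is_derive n.+1 t0.
  have E : {near t, (fun u => y n.+1 u * (p n.+1 u + p n u)) =1
      (fun u => - B n.+1 u)}.
    near=> u; apply: link; near: u; exact: lt_nbhsr.
  have L : is_derive t 1 (fun u => y n.+1 u * (p n.+1 u + p n u))
     ((y n.+1 t * (p n.+1 t - p n t) * (p n.+1 t + p n t)
      + y n.+1 t * (v n.+2 t - v n.+1 t + (v n.+1 t - v n t))) / t).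
    by apply: is_derive_eq; rewrite /GRing.scale/= /p /v al_succ; ring.
  have Rh : is_derive t 1 (fun u => - B n.+1 u)
     (- (B n.+1 t + (t + al n.+1) * (y n.+1 t * (p n.+1 t - p n t))) / t).
    by apply: is_derive_eq; rewrite /GRing.scale/= /B /p /v al_succ; field.
  have /(congr1 (fun z => z * t / y n.+1 t)) := is_derive_unique E L Rh.
  rewrite !divfK// eB.
  have yn0 := y_neq0 n t0.
  have -> : forall x z w, (y n.+1 t * x * z + y n.+1 t * w) / y n.+1 t = x * z + w.
    by move=> ? ? ?; field.
  have -> : forall x z,
    - (- (y n.+1 t * x) + z * (y n.+1 t * (p n.+1 t - p n t))) / y n.+1 t =
    x - z * (p n.+1 t - p n t).
    by move=> ? ?; field.
  move=> /eqP; rewrite -subr_eq0 => /eqP Q.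
  apply/eqP; rewrite -subr_eq0 -Q al_succ P2; apply/eqP; ring.
- apply: is_derive_eq; congr (_ / _); rewrite eB /p al_succ; ring.
Unshelve. all: by end_near. Qed.

(** Here z = t y_n' = t^2 H_n'', and the equation is the claimed one multiplied by t^2. *)
Lemma toda_ode n (t : R) : 0 < t ->
  exists z, is_derive t 1 (y n) (z / t) /\
    z ^+ 2 = (t * y n t + (a - 2 * n%:R + 2) * (y n t + H n t)
        + n%:R * (n%:R + (a - 2 * n%:R + 2) + beta) * t) ^+ 2
      + 4 * (y n t + H n t) * y n t * (beta * t - (y n t + H n t)).
Proof.
rewrite -/(al n) -/(c n) -/(v n t) -/(B n t).
move: t; have hyp : forall t, 0 < t -> toda_invariant n t.
  by elim: n => [|m IH]; [exact: toda_invariant_base|exact: toda_invariant_step].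
move=> t /hyp[P1 _ P3].
exists (2 * y n t * p n t + B n t); split => //.
have -> : 4 * v n t * y n t * (beta * t - v n t) =
  4 * y n t * (v n t * (beta * t - v n t)) by ring.
by rewrite -P1; ring.
Qed.

End TodaInduction.


(** * The tau functions *)

Section Tau.
Variables (R : realType) (beta a : R).
Hypothesis hbeta : 0 < beta.

Local Notation G := (moment_entry beta a).

(** The matrix is symmetric, so differentiating the last row or the last column comes to the
    same. *)
Lemma minor_sym t n r c : minor (G t) n r c = minor (G t) n c r.
Proof.
rewrite /minor -[LHS]det_tr; apply: congr1; apply/matrixP => i j.
by rewrite !mxE /moment_entry addrAC.
Qed.

Lemma moment_entry_is_derive (i j : nat) (t : R) : 0 < t ->
  is_derive t 1 (fun s => G s i j) (- G t i.+1 j).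
Proof.
move=> t0; have := mom_is_derive hbeta (a - i%:R - j%:R) t0.
rewrite /moment_entry -natr1.
by rewrite (_ : a - (i%:R + 1) - j%:R = a - i%:R - j%:R - 1)//; ring.
Qed.

(* In the sum over differentiated rows, only the last one survives: shifting
   any other row duplicates the next one. *)
Lemma minor_is_derive m (c : nat -> nat) (t : R) : 0 < t ->
  is_derive t 1 (fun s => minor (G s) m.+1 id c) (- minor (G t) m.+1 (skip m) c).
Proof.
move=> t0; rewrite /minor.
have dA (i j : 'I_m.+1) :
    is_derive t 1 (fun s => (\matrix_(i < m.+1, j < m.+1) G s i (c j)) i j)
      ((\matrix_(i < m.+1, j < m.+1) - G t i.+1 (c j)) i j).
  by under eq_fun do rewrite mxE; rewrite mxE; exact: moment_entry_is_derive.
apply: (is_derive_eq (is_derive_det dA)).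
rewrite big_ord_recr big1 /= ?add0r => [|i _].
(* Multilinearity with coefficients -1 and 0 pulls the sign out of the differentiated row. *)
- rewrite (@determinant_multilinear _ _ _
    (\matrix_(i < m.+1, j < m.+1) G t (skip m i) (c j))
    (\matrix_(i < m.+1, j < m.+1) G t (skip m i) (c j)) ord_max (-1) 0).
  + by rewrite mul0r addr0 mulN1r.
  + by apply/rowP => j; rewrite !mxE eqxx /skip ltnn mul0r addr0 mulN1r.
  + apply/matrixP => i j; rewrite !mxE eq_sym (negbTE (neq_lift _ _)).
    by rewrite /skip lift_max ltn_ord.
  + apply/matrixP => i j; rewrite !mxE eq_sym (negbTE (neq_lift _ _)).
    by rewrite /skip lift_max ltn_ord.
- pose B := \matrix_(k < m.+1, j < m.+1)
    (if k == widen_ord (leqnSn m) i then G t i.+1 (c j) else G t k (c j)).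
  rewrite (@determinant_multilinear _ _ _ B B (widen_ord (leqnSn m) i) (-1) 0).
  + rewrite (@determinant_alternate _ _ B (widen_ord (leqnSn m) i) (lift ord0 i)).
    * by rewrite mulr0 mul0r addr0.
    * by rewrite -val_eqE /= /bump /= add1n neq_ltn ltnSn.
    * move=> j; rewrite !mxE eqxx ifN//=.
      by rewrite -val_eqE /= /bump /= add1n neq_ltn ltnSn orbT.
  + by apply/rowP => j; rewrite !mxE eqxx mul0r addr0 mulN1r.
  + by apply/matrixP => k j; rewrite !mxE eq_sym (negbTE (neq_lift _ _)).
  + by apply/matrixP => k j; rewrite !mxE eq_sym (negbTE (neq_lift _ _)).
Qed.

Definition tau n t := minor (G t) n id id.

(* [dtau] and [ddtau] are [- tau'] and [tau'']. *)
Definition dtau n t := if n is m.+1 then minor (G t) m.+1 id (skip m) else 0.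
Definition ddtau n t := if n is m.+1 then minor (G t) m.+1 (skip m) (skip m) else 0.
Arguments dtau n t : simpl never.
Arguments ddtau n t : simpl never.

Lemma tau_is_derive n (t : R) : 0 < t -> is_derive t 1 (tau n) (- dtau n t).
Proof.
move=> t0; case: n => [|m]; last first.
  by rewrite /dtau minor_sym; exact: minor_is_derive.
rewrite oppr0; have -> : tau 0 = cst 1 by apply/funext => s; exact: det_mx00.
exact: is_derive_cst.
Qed.

Lemma dtau_is_derive n (t : R) : 0 < t -> is_derive t 1 (dtau n) (- ddtau n t).
Proof.
move=> t0; case: n => [|m]; last exact: minor_is_derive.
by rewrite oppr0; exact: is_derive_cst.
Qed.

Lemma tau_gt0 n t : 0 < t -> 0 < tau n t.
Proof. exact: moment_minor_gt0. Qed.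

(** The Desnanot-Jacobi identity, whose bordered minors are tau_{n+1} and its first two derivatives
    up to sign. *)
Lemma tau_toda n t : 0 < t ->
  ddtau n.+1 t * tau n.+1 t - dtau n.+1 t ^+ 2 = tau n.+2 t * tau n t.
Proof.
move=> t0; rewrite /ddtau /dtau expr2.
rewrite {2}minor_sym.
apply: minor_jacobi.
exact/lt0r_neq0/tau_gt0.
Qed.

Definition Hn n t := - (t * dtau n t / tau n t).
(** This is t^2 (ln tau_n)'', that is, t H_n' - H_n. *)
Definition yn n t :=
  t ^+ 2 * (ddtau n t * tau n t - dtau n t ^+ 2) / tau n t ^+ 2.

Lemma Hn_is_derive n (t : R) : 0 < t -> is_derive t 1 (Hn n) ((yn n t + Hn n t) / t).
Proof.
move=> t0; have d0 := tau_is_derive n t0; have d1 := dtau_is_derive n t0.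
have t_neq0 : t != 0 by rewrite gt_eqF.
have tau_neq0 : tau n t != 0 by rewrite gt_eqF ?tau_gt0.
have d2 := is_deriveV tau_neq0 d0.
apply: is_derive_eq; rewrite /GRing.scale/= /yn /Hn; field.
by rewrite t_neq0 tau_neq0.
Qed.

(** Logarithmic derivative of t^2 tau_{n+2} tau_n / tau_{n+1}^2, which is y_{n+1} by [tau_toda]. *)
Lemma yn_is_derive n (t : R) : 0 < t -> is_derive t 1 (yn n.+1)
  (yn n.+1 t * (2 + Hn n.+2 t + Hn n t - 2 * Hn n.+1 t) / t).
Proof.
move=> t0.
have t_neq0 : t != 0 by rewrite gt_eqF.
have tau_neq0 k : tau k t != 0 by rewrite gt_eqF ?tau_gt0.
apply: (@near_eq_is_derive R R^o R^o
   (fun s => s ^+ 2 * (tau n.+2 s * tau n s) * (tau n.+1 s)^-1 ^+ 2)).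
  near=> s; have s0 : 0 < s by near: s; exact: lt_nbhsr.
  by rewrite /yn tau_toda// exprVn.
have d0 := tau_is_derive n t0; have d1 := tau_is_derive n.+1 t0.
have d2 := tau_is_derive n.+2 t0.
have d3 := is_deriveV (tau_neq0 n.+1) d1.
apply: is_derive_eq; rewrite /GRing.scale/= /yn tau_toda// /Hn; field.
by rewrite t_neq0 !tau_neq0.
Unshelve. all: by end_near. Qed.

Lemma yn_gt0 n t : 0 < t -> 0 < yn n.+1 t.
Proof.
move=> t0; rewrite /yn tau_toda//.
by rewrite divr_gt0 ?mulr_gt0 ?exprn_gt0 ?tau_gt0.
Qed.

(** As tau_1 = M(a), with derivatives -M(a - 1) and M(a - 2), the recurrence at s = a - 2 is a
    linear second order equation for tau_1, hence a Riccati equation for its logarithmic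
    derivative. *)
Lemma yn1_riccati t : 0 < t ->
  yn 1 t = (a - t) * Hn 1 t + (a + 1 + beta) * t - Hn 1 t ^+ 2.
Proof.
move=> t0.
have tau_neq0 : tau 1 t != 0 by rewrite gt_eqF ?tau_gt0.
have e0 : tau 1 t = mom beta a t.
  by rewrite /tau /minor det_mx11 mxE /moment_entry !subr0.
have e1 : dtau 1 t = mom beta (a - 1) t.
  by rewrite /dtau /minor det_mx11 mxE /moment_entry /skip subr0.
have e2 : ddtau 1 t = mom beta (a - 2) t.
  by rewrite /ddtau /minor det_mx11 mxE /moment_entry /skip /= -addrA -opprD -natrD.
have := mom_recurrence hbeta (a - 2) t0.
have -> : a - 2 + 1 = a - 1 by ring.
have -> : a - 2 + 2 = a by ring.
rewrite -e0 -e1 -e2 => /eqP; rewrite -subr_eq0 => /eqP Q.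
have -> : yn 1 t = t ^+ 2 * ddtau 1 t / tau 1 t - Hn 1 t ^+ 2.
  by rewrite /yn /Hn; field.
apply/eqP; rewrite -subr_eq0; apply/eqP.
transitivity (t / tau 1 t * (t * ddtau 1 t + (a - t) * dtau 1 t
    - (a - 2 + 3 + beta) * tau 1 t)); last by rewrite Q mulr0.
by rewrite /Hn; field.
Qed.

End Tau.

(** * The Hankel determinant as a tau function *)

Section Link.
Variables (R : realType) (alpha beta : R).
Hypotheses (halpha : 0 < alpha) (hbeta : 0 < beta).

Lemma pj_moment_mom (t : R) k : pj_moment alpha beta t k = mom beta (alpha + k%:R) t.
Proof.
apply: eq_Rintegral => x; rewrite inE/= in_itv/= => /andP[x0 _].
(* At 0 the weight vanishes because [alpha] is nonzero, in agreement with the convention in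
   [kern]. *)
rewrite /pj_weight; have [->|x_neq0] := eqVneq x 0.
  by rewrite /kern ltxx powR0 ?gt_eqF// !(mulr0, mul0r).
have {}x0 : 0 < x by rewrite lt_neqAle eq_sym x_neq0.
by rewrite kern_shift// powR_mulrn ?ltW// /kern x0.
Qed.

(** Reversing rows and columns turns the exponent alpha + i + j into alpha + 2(n - 1) - i - j; the
    same permutation acts on both sides, so its sign is squared. *)
Lemma hankel_det_tau n (t : R) :
  hankel_det alpha beta n t = tau beta (alpha + 2 * n%:R - 2) n t.
Proof.
pose s : 'S_n := perm (@rev_ord_inj n).
rewrite /hankel_det /tau /minor.
have -> : \matrix_(i < n, j < n) pj_moment alpha beta t (i + j) =
    row_perm s (col_perm s (\matrix_(i < n, j < n)
       moment_entry beta (alpha + 2 * n%:R - 2) t i j)).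
  apply/matrixP => i j; rewrite !mxE !permE pj_moment_mom /moment_entry.
  apply: (congr1 (fun r => mom beta r t)).
  have revE (k : 'I_n) : (n - k.+1)%:R = n%:R - k%:R - 1 :> R.
    by rewrite natrB ?ltn_ord// -natr1 opprD addrA.
  rewrite /= !revE natrD.
  by move: (i%:R) (j%:R) (n%:R) => x y z; ring.
rewrite row_permE col_permE !det_mulmx !det_perm odd_permV mulrCA -expr2.
by rewrite sqrr_sign mulr1.
Qed.

End Link.

Theorem theorem5p4 (R : realType) (alpha beta : R) (n : nat)
    (halpha : 0 < alpha) (hbeta : 0 < beta) :
  let D := hankel_det alpha beta n in
  let H := H_fun alpha beta n in
  let H1 := H^`()%classic in
  let H2 := H1^`()%classic in
  forall t : R, 0 < t ->
    [/\ 0 < D t,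
        derivable (fun s => ln (D s)) t 1,
        derivable H t 1,
        derivable H1 t 1 &
        (t * H2 t) ^+ 2 =
          (n%:R * (n%:R + alpha + beta) - H t + (alpha + t) * H1 t) ^+ 2
          + 4 * H1 t * (t * H1 t - H t) * (beta - H1 t)].
Proof.
move=> D H H1 H2.
pose a := alpha + 2 * n%:R - 2.
have DE : D = tau beta a n by apply/funext => s; exact: hankel_det_tau.
have D_gt0 s : 0 < s -> 0 < D s by rewrite DE; exact: tau_gt0.
have lnD_is_derive (s : R) : 0 < s ->
    is_derive s 1 (fun u => ln (D u)) (- dtau beta a n s / tau beta a n s).
  move=> s0; rewrite DE; have d := tau_is_derive a hbeta n s0.
  have dln := is_derive1_ln (tau_gt0 a hbeta n s0).
  have := @is_derive1_comp _ _ (tau beta a n) _ _ _ dln d.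
  by rewrite mulrC.
have HE s : 0 < s -> H s = Hn beta a n s.
  move=> s0; rewrite /H /H_fun derive1E.
  by have [_ ->] := lnD_is_derive _ s0; rewrite /Hn; ring.
pose v s := yn beta a n s + Hn beta a n s.
have H_is_derive (s : R) : 0 < s -> is_derive s 1 H (v s / s).
  (* [H] is identified with [Hn] only on the positive half-line, so derivatives are transferred by
     equality near the point. *)
  move=> s0; apply: (@near_eq_is_derive R R^o R^o (Hn beta a n)).
    near=> u; rewrite HE//; near: u; exact: lt_nbhsr.
  exact: Hn_is_derive.
have H1E s : 0 < s -> H1 s = v s / s.
  by move=> s0; rewrite /H1 derive1E; have [_ ->] := H_is_derive _ s0.
move=> t t0; have t_neq0 : t != 0 by rewrite gt_eqF.
have Hn0 s : 0 < s -> Hn beta a 0 s = 0.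
  by move=> s0; rewrite /Hn /dtau mulr0 mul0r oppr0.
have yn0 s : 0 < s -> yn beta a 0 s = 0.
  by move=> s0; rewrite /yn /ddtau /dtau mul0r expr0n subr0 mulr0 mul0r.
have y_neq0 k (s : R) : 0 < s -> yn beta a k.+1 s != 0.
  by move=> s0; rewrite gt_eqF// yn_gt0.
have [z [dy]] := toda_ode (Hn_is_derive a hbeta) y_neq0
  (yn_is_derive a hbeta) Hn0 yn0 (yn1_riccati a hbeta) n t0.
have -> : a - 2 * n%:R + 2 = alpha by rewrite /a; ring.
rewrite -/(v t) => zE.
have H1_is_derive : is_derive t 1 H1 (z / t ^+ 2).
  apply: (@near_eq_is_derive R R^o R^o (fun s => v s * s^-1)).
    near=> u; rewrite H1E//; near: u; exact: lt_nbhsr.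
  have dH := Hn_is_derive a hbeta n t0.
  have dV := is_deriveV t_neq0 (is_derive_id t 1).
  apply: is_derive_eq; rewrite /GRing.scale/= -/(v t); field.
  exact: t_neq0.
have H2E : H2 t = z / t ^+ 2 by rewrite /H2 derive1E; have [_ ->] := H1_is_derive.
split.
- exact: D_gt0.
- by have [] := lnD_is_derive _ t0.
- by have [] := H_is_derive _ t0.
- by have [] := H1_is_derive.
- rewrite H2E HE// H1E//.
  have -> : (t * (z / t ^+ 2)) ^+ 2 = z ^+ 2 / t ^+ 2 by field.
  by rewrite zE /v; field.
Unshelve. all: by end_near. Qed.
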